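(* Let $p$ be a prime, let $G$ be a finite group, let $S\in\mathrm{Syl}_p(G)$, and let $D$ be a strongly closed subgroup in $S$ with respect to $G$. Then $G$ is $p$-nilpotent if and only if $N_G(U)$ is $p$-nilpotent for all $U\le D$ such that $C_D(U)\le U$.
   Context: For $D\le S\le G$, $D$ is strongly closed in $S$ with respect to $G$ if $x^g\in D$ whenever $x\in D$, $g\in G$ and $x^g\in S$. A finite group is $p$-nilpotent if it has a normal $p$-complement. *)

(* Defs.v *)
From mathcomp Require Import all_boot all_fingroup all_solvable.

Set Implicit Arguments.
Unset Strict Implicit.
Unset Printing Implicit Defensive.

Local Open Scope group_scope.

Definition strongly_closed (gT : finGroupType) (D S G : {set gT}) : Prop :=
  [/\ D \subset S, S \subset G
    & forall x g, x \in D -> g \in G -> x ^ g \in S -> x ^ g \in D].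

(* A p-complement of G is a Hall p'-subgroup of G, i.e. a p'-subgroup of
   p-power index. *)
Definition p_nilpotent (p : nat) (gT : finGroupType) (G : {set gT}) : Prop :=
  exists K : {group gT}, K <| G /\ p^'.-Hall(G) K.

(* Main.v *)
(* Alperin's downward induction, run inside D, shows that S controls the fusion
   of D as soon as the normalisers of the self-centralising subgroups of D are
   p-nilpotent.  If D is trivial then G = 'N_G(D).  Otherwise Z = D :&: 'Z(S) is
   nontrivial and each of its elements is its only conjugate in S, so 'C_G(Z)
   controls fusion in S; by induction on the order 'C_G(Z) / Z is p-nilpotent,
   hence so is its central p-extension 'C_G(Z), and S controls its own fusion in
   G.  Frobenius' criterion, which follows from the same Alperin argument with
   D = S and the transfer from S to S / S', then makes G p-nilpotent. *)
Require Import Defs.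
From mathcomp Require Import all_boot all_fingroup all_solvable.
From mathcomp Require Import ssralg.

Set Implicit Arguments.
Unset Strict Implicit.
Unset Printing Implicit Defensive.

Import FiniteModule.

Local Open Scope group_scope.

(** * Transfer to the abelianised Sylow subgroup *)

(** Control makes the transfer send [g] in [S] to [g ^+ #|G : S|] modulo the derived subgroup of
    [S]. The index is prime to [p], so the transfer kernel, taken as [N], cannot contain [S]. *)
Lemma transfer_p_quotient (p : nat) (gT : finGroupType) (G S : {group gT}) :
    p.-Sylow(G) S -> S :!=: 1 ->
    (forall x u, x \in S -> u \in G -> x ^ u \in S ->
       exists2 s, s \in S & x ^ u = x ^ s) ->
  exists N : {group gT}, [/\ N \proper G, N <| G & p.-group (G / N)].
Proof.
move=> sylS ntS ctl; have [sSG pS p'iS] := and3P sylS.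
have S'pr : S^`(1) \proper S.
  exact: sol_der1_proper (pgroup_sol pS) (subxx _) ntS.
have nS'S : S \subset 'N(S^`(1)) by exact: der_norm.
pose alpha := restrm_morphism nS'S (coset_morphism S^`(1)).
have imA : alpha @* S = S / S^`(1) by rewrite morphim_restrm setIid.
have abA : abelian (alpha @* S) by rewrite imA; exact: der_abelian 0 S.
have VE g : g \in S ->
    transfer G abA g = (fmod abA (alpha g) *+ #|G : S|)%R.
  move=> Sg; have Gg := subsetP sSG _ Sg.
  set P := rcosets S G :* <[g]>.
  have partP : partition P G := rcosets_cycle_partition sSG Gg.
  have trX := transversalP partP; set X := transversal P G in trX.
  rewrite (transfer_cycle_expansion sSG abA Gg trX).
  rewrite -(sum_index_rcosets_cycle sSG Gg trX) -GRing.sumrMnr.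
  apply: eq_bigr => x Xx.
  have Gx : x \in G by have /subsetP := transversal_sub trX; apply.
  set n := #|_ : _|; have Sgn : g ^+ n \in S by rewrite groupX.
  (* [n] is the length of the cycle of [g] through the coset [S :* x], so [g ^+ n] fixes that
     coset. *)
  have Sgnx : (g ^+ n) ^ x^-1 \in S.
    by have := mulg_exp_card_rcosets S g x; rewrite mem_rcoset conjgE invgK mulgA.
  have [s Ss ->] := ctl _ _ Sgn (groupVr Gx) Sgnx.
  rewrite /restrm /= -fmodX; last by rewrite mem_morphim.
  congr (fmod abA _).
  rewrite -(morphX alpha) // (morphJ alpha) //.
  rewrite conjgE (centsP abA _ (mem_morphim alpha Sgn Sgn) _ (mem_morphim alpha Ss Ss)).
  by rewrite mulKg.
exists ('ker (transfer_morphism G abA))%G; split.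
- rewrite properE subsetIl /=; apply: contra (proper_subn S'pr) => sGker.
  apply/subsetP=> g Sg; have Gg := subsetP sSG g Sg.
  have /mker /= := subsetP sGker g Gg.
  rewrite VE // -fmodX ?mem_morphim // -(morphX alpha) // => /(congr1 val).
  rewrite /= fmodK ?mem_morphim ?groupX // => /coset_idr.
  have nS'g := subsetP nS'S g Sg; move/(_ (groupX _ nS'g)) => S'gn.
  have co : coprime #|S| #|G : S| by apply: pnat_coprime pS p'iS.
  by rewrite -(expgK co Sg) groupX.
- exact: ker_normal.
rewrite /= (isog_pgroup _ (first_isog _)).
pose f := Morphism (fmodM abA).
apply: (@pgroupS _ _ (f @* (alpha @* S))); last exact/morphim_pgroup/morphim_pgroup.
apply/subsetP=> u _; rewrite -[u]fmvalK; exact: (mem_morphim f (fmodP u) (fmodP u)).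
Qed.

(** * Control of fusion and Alperin's induction *)

(** The factorisation says that [g] acts on [P] as its factor in [S] does; that factor need not lie
    in [D]. *)
Definition controls_fusion (gT : finGroupType) (S D G : {set gT}) : Prop :=
  forall (P : {group gT}) g,
    P \subset D -> g \in G -> P :^ g \subset D -> g \in 'C_G(P) * S.

Lemma control_conj (gT : finGroupType) (S D G : {group gT}) x g :
    controls_fusion S D G -> x \in D -> g \in G -> x ^ g \in D ->
  exists2 s, s \in S & x ^ g = x ^ s.
Proof.
move=> ctl Dx Gg Dxg.
have: g \in 'C_G(<[x]>) * S by apply: ctl; rewrite /= -?cycleJ ?cycle_subG.
case/mulsgP=> c s /setIP[_]; rewrite cent_cycle => /cent1P cxc Ss ->.
by exists s => //; rewrite conjgM (conjg_fixP (introT commgP (esym cxc))).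
Qed.

(** Moving [s] to the right of [c'] replaces [c'] by [c' ^ s^-1], which centralises [P] because
    [P :^ g = P :^ s]. *)
Lemma cent_mulM (gT : finGroupType) (G S P : {group gT}) g h :
    S \subset G -> g \in 'C_G(P) * S -> h \in 'C_G(P :^ g) * S ->
  g * h \in 'C_G(P) * S.
Proof.
move=> sSG /mulsgP[c s /setIP[Gc cPc] Ss ->].
rewrite conjsgM (normP (subsetP (cent_sub P) c cPc)).
case/mulsgP=> c' s' /setIP[Gc' cPc'] Ss' ->.
have cPc's : c' ^ s^-1 \in 'C(P) by rewrite -mem_conjg -centJ.
have -> : c * s * (c' * s') = (c * c' ^ s^-1) * (s * s').
  by rewrite conjgE invgK !mulgA mulgKV.
apply: mem_mulg; last exact: groupM.
have Gs := subsetP sSG s Ss.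
by rewrite groupM // in_setI ?Gc // groupJ ?groupV.
Qed.

Lemma cent_mulV (gT : finGroupType) (G S P : {group gT}) g :
    S \subset G -> g \in 'C_G(P) * S -> g^-1 \in 'C_G(P :^ g) * S.
Proof.
move=> sSG /mulsgP[c s /setIP[Gc cPc] Ss ->].
rewrite conjsgM (normP (subsetP (cent_sub P) c cPc)).
have -> : (c * s)^-1 = (c^-1 ^ s) * s^-1 by rewrite conjgE invMg !mulgA mulgK.
apply: mem_mulg; last exact: groupVr.
have Gs := subsetP sSG s Ss.
by rewrite in_setI groupJ ?groupV //= centJ memJ_conjg groupV.
Qed.

(** A Sylow subgroup maps onto every p-group quotient, so [T] covers the automizer of [Q]. *)
Lemma p_automizer_norm (p : nat) (gT : finGroupType) (G Q T : {group gT}) :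
    p.-group ('N_G(Q) / 'C(Q)) -> p.-Sylow('N_G(Q)) T ->
  'N_G(Q) \subset 'C_G(Q) * T.
Proof.
move=> pN sylT; have [sTN _ _] := and3P sylT.
have nCN : 'N_G(Q) \subset 'N('C(Q)) by rewrite subIset ?cent_norm ?orbT.
have sNCT : 'N_G(Q) \subset 'C(Q) * T.
  by rewrite -quotientSK // (pHall_id (quotient_pHall (subset_trans sTN nCN) sylT) pN).
apply/subsetP=> n Nn; have /mulsgP[c t cQc Tt def_n] := subsetP sNCT n Nn.
have [[Gn _] [Gt _]] := (setIP Nn, setIP (subsetP sTN t Tt)).
by rewrite def_n mem_mulg // inE cQc andbT -(mulgK t c) -def_n groupM ?groupV.
Qed.

Lemma strongly_closed_conj (gT : finGroupType) (D S G A : {set gT}) g :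
    strongly_closed D S G -> A \subset D -> g \in G -> A :^ g \subset S ->
  A :^ g \subset D.
Proof.
case=> _ _ scD sAD Gg sAgS; apply/subsetP=> _ /imsetP[x Ax ->].
by rewrite scD ?(subsetP sAD) // (subsetP sAgS) // memJ_conjg.
Qed.

(* Let [Q] be a fully normalised conjugate of [P].  After correction by an
   element of ['N_G(Q)], a conjugation of [P] to [Q] extends to ['N_D(P)]; and,
   when [Q] is not self-centralising, the Frattini argument lets us extend an
   element of ['N_G(Q)], corrected by ['C_G(Q)], to [Q <*> 'C_D(Q)]. *)
Lemma strongly_closed_control (p : nat) (gT : finGroupType) (G S D : {group gT}) :
    p.-Sylow(G) S -> strongly_closed D S G ->
    (forall Q : {group gT}, Q \subset D -> 'C_D(Q) \subset Q ->
       p.-group ('N_G(Q) / 'C(Q))) ->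
  controls_fusion S D G.
Proof.
move=> sylS scD autD; have [sSG pS _] := and3P sylS; have [sDS _ _] := scD.
have sDG := subset_trans sDS sSG.
move=> P g sPD Gg sPgD; have [n] := ubnP (#|D| - #|P|).
elim: n => // n IHn in P g sPD Gg sPgD *; rewrite ltnS => leDPn.
have IH (R : {group gT}) h : R \subset D -> h \in G -> R :^ h \subset D ->
    #|P| < #|R| -> h \in 'C_G(R) * S.
  move=> sRD Gh sRhD ltPR; apply: IHn => //; apply: leq_trans leDPn.
  by apply: ltn_sub2l => //; apply: leq_trans ltPR (subset_leq_card sRD).
have centS (R R' : {group gT}) h :
    R \subset R' -> h \in 'C_G(R') * S -> h \in 'C_G(R) * S.
  by move=> sRR'; apply/subsetP/mulSg/setIS/centS.
have [T sylT] := Sylow_exists p 'N_G(P).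
have [sTN pT _] := and3P sylT.
have sPG := subset_trans sPD sDG.
have [x Gx sTxS] := Sylow_Jsub sylS (subset_trans sTN (subsetIl _ _)) pT.
pose Q := (P :^ x)%G.
have sPT : P \subset T.
  have: P <| 'N_G(P) by rewrite normal_subnorm.
  exact: normal_sub_max_pgroup (Hall_max sylT) (pgroupS (subset_trans sPD sDS) pS).
have sQD : Q \subset D.
  by apply: (strongly_closed_conj scD) => //; apply: subset_trans sTxS; rewrite conjSg.
have cardQ : #|Q| = #|P| by rewrite cardJg.
have NQ : 'N_G(Q) = 'N_G(P) :^ x by rewrite conjIg normJ conjGid.
(* This is what fully normalised means: [T :^ x] is Sylow in ['N_G(Q)] and lies in the p-group
   ['N_S(Q)], hence equals it. *)
have sylNQ : p.-Sylow('N_G(Q)) 'N_S(Q).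
  have sylTx : p.-Sylow('N_G(Q)) (T :^ x) by rewrite NQ pHallJ2.
  have sTxN : T :^ x \subset 'N_S(Q).
    by rewrite subsetI sTxS (subset_trans (pHall_sub sylTx)) ?subsetIr.
  have pNS : p.-group 'N_S(Q) by apply: pgroupS (subsetIl _ _) pS.
  suff <- : T :^ x = 'N_S(Q) by [].
  apply/eqP; rewrite eqEsubset sTxN /=.
  by rewrite -(sub_pHall sylTx pNS sTxN) // setSI.
have NQgood h : h \in 'N_G(Q) -> h \in 'C_G(Q) * S.
  move=> NQh; have [sCQ | nsCQ] := boolP ('C_D(Q) \subset Q).
    have /subsetP/(_ h NQh) := p_automizer_norm (autD Q sQD sCQ) sylNQ.
    by apply/subsetP/mulgS; rewrite subsetIl.
  have sylCS : p.-Sylow('C_G(Q)) 'C_S(Q).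
    have -> : 'C_S(Q) = 'C_G(Q) :&: 'N_S(Q).
      by rewrite setIACA (setIidPr sSG) (setIidPl (cent_sub Q)).
    exact: Sylow_setI_normal (subcent_normal G Q) sylNQ.
  have := NQh; rewrite -(Frattini_arg (subcent_normal G Q) sylCS).
  case/mulsgP=> c m cQc /setIP[/setIP[Gm nQm] nCm] ->.
  have cQm : c \in 'C_G(Q) * S by rewrite -[c]mulg1 mem_mulg.
  apply: cent_mulM => //.
  rewrite (normP (subsetP (cent_sub Q) c (subsetP (subsetIr G _) c cQc))).
  (* [m] normalises [Q] and ['C_S(Q)], though perhaps not [D]; so [R :^ m] lies in [S], and strong
     closure returns it to [D]. *)
  pose R := (Q <*> 'C_D(Q))%G.
  have sRD : R \subset D by rewrite join_subG sQD subsetIl.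
  apply: (centS _ R); first exact: joing_subl.
  apply: IH => //; last first.
    by rewrite -cardQ; apply/proper_card; rewrite properE joing_subl join_subG subxx.
  apply: (strongly_closed_conj scD) => //.
  rewrite sub_conjg join_subG -!sub_conjg (normP nQm) (subset_trans sQD) //=.
  apply: subset_trans (subsetIl S 'C(Q)).
  by rewrite -(normP nCm) conjSg setSI.
have toQ (R : {group gT}) h : R \subset D -> h \in G -> R :^ h = Q ->
    h \in 'C_G(R) * S.
  move=> sRD Gh RhQ; have cardR : #|R| = #|P| by rewrite -cardQ -RhQ cardJg.
  (* If [R] is all of [D], its normaliser in [D] cannot grow, but then [R = Q] and [h] normalises
     [Q]. *)
  have [sDR | nsDR] := boolP (D \subset R).
    have eqQR : Q :=: R.
      by apply/eqP; rewrite eqEcard (subset_trans sQD sDR) cardR cardQ /=.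
    by rewrite -eqQR NQgood // inE Gh; apply/normP; rewrite eqQR RhQ.
  have ltRD : R \proper D by rewrite properE sRD.
  have pNR : p.-group ('N_D(R) :^ h).
    by rewrite pgroupJ (pgroupS _ pS) // subIset ?sDS.
  have sNRQ : 'N_D(R) :^ h \subset 'N_G(Q).
    rewrite -RhQ normJ subsetI !conjSg subsetIr andbT.
    by rewrite -(conjGid Gh) conjSg subIset ?sDG.
  (* Sylow's theorem in ['N_G(Q)] moves the extended conjugate into [S]. The induction then handles
     [h * m] on ['N_D(R)], and [NQgood] removes [m]. *)
  have [m NQm sNRm] := Sylow_Jsub sylNQ sNRQ pNR.
  have [Gm nQm] := setIP NQm; rewrite -conjsgM in sNRm.
  have hm : h * m \in 'C_G(R) * S.
    apply: (centS _ 'N_D(R)%G); first by rewrite subsetI sRD normG.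
    apply: IH; rewrite ?subsetIl ?groupM //.
      apply: (strongly_closed_conj scD); rewrite ?subsetIl ?groupM //.
      exact: subset_trans sNRm (subsetIl _ _).
    rewrite -cardR; apply/proper_card/nilpotent_proper_norm => //.
    exact: pgroup_nil (pgroupS sDS pS).
  rewrite -(mulgK m h); apply: cent_mulM => //.
  by rewrite conjsgM RhQ (normP nQm) NQgood // groupV.
(* [x] carries [P] to [Q] and [g^-1 * x] carries [P :^ g] to [Q]; [g] is the first followed by the
   inverse of the second. *)
have Px : x \in 'C_G(P) * S by apply: toQ.
have Pgx : g^-1 * x \in 'C_G(P :^ g) * S.
  by apply: (toQ (P :^ g)%G); rewrite ?groupM ?groupV //= -conjsgM mulKVg.
have Vx := cent_mulV sSG Pgx; rewrite -conjsgM mulKVg in Vx.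
by have := cent_mulM sSG Px Vx; rewrite invMg invgK mulKVg.
Qed.

(** * Subgroups, quotients and extensions of p-nilpotent groups *)

Lemma p_nilpotentS (p : nat) (gT : finGroupType) (G H : {group gT}) :
  H \subset G -> p_nilpotent p G -> p_nilpotent p H.
Proof.
move=> sHG [K [nsKG hallK]]; exists (K :&: H)%G.
split; last exact: setI_normal_Hall hallK sHG.
by rewrite /= setIC (normalGI sHG).
Qed.

Lemma quotient_p_nilpotent (p : nat) (gT : finGroupType) (G H : {group gT}) :
  G \subset 'N(H) -> p_nilpotent p G -> p_nilpotent p (G / H).
Proof.
move=> nHG [K [nsKG hallK]]; exists (K / H)%G.
split; first exact: quotient_normal.
exact: quotient_pHall (subset_trans (normal_sub nsKG) nHG) hallK.
Qed.

(** The p-complement of [N] is its p'-core, which is characteristic in [N] and so normal in [G]. *)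
Lemma p_nilpotent_ext (p : nat) (gT : finGroupType) (G N : {group gT}) :
  N <| G -> p.-group (G / N) -> p_nilpotent p N -> p_nilpotent p G.
Proof.
move=> nsNG pGN [K [nsKN hallK]]; exists K; have [sNG nNG] := andP nsNG.
have [sKN p'K piK] := and3P hallK; split.
  rewrite -(normal_Hall_pcore hallK nsKN).
  exact: char_normal_trans (pcore_char _ _) nsNG.
rewrite /pHall (subset_trans sKN) // p'K /= -(Lagrange_index sNG sKN) pnatM piK andbT.
by rewrite pnatNK -card_quotient.
Qed.

(** The preimage [K] of the complement has [Z] as a central Sylow subgroup. Schur-Zassenhaus splits
    off [L], which is normal in [K = Z * L] because [Z] centralises it. *)
Lemma p_nilpotent_central_quotient (p : nat) (gT : finGroupType) (G Z : {group gT}) :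
    Z \subset 'Z(G) -> p.-group Z -> p_nilpotent p (G / Z) ->
  p_nilpotent p G.
Proof.
move=> sZZ pZ [Kb [nsKb hallKb]]; have [sZG cGZ] := subsetIP sZZ.
have nsZG : Z <| G by rewrite sub_center_normal.
have [K defKb sZK nsKG] := inv_quotientN nsZG nsKb.
have [sKG nKG] := andP nsKG; have [sKbG p'Kb pGKb] := and3P hallKb.
have nsZK : Z <| K := normalS sZK sKG nsZG.
apply: (p_nilpotent_ext nsKG).
  rewrite /pgroup card_quotient // -(index_quotient_eq _ sKG (normal_norm nsZG)).
    by rewrite -defKb -pnatNK.
  by rewrite subIset ?sZK ?orbT.
have sylZ : p.-Sylow(K) Z.
  by rewrite /pHall sZK pZ -card_quotient ?normal_norm // -defKb.
have /splitsP[L complL] := SchurZassenhaus_split (pHall_Hall sylZ) nsZK.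
exists L; split; last by rewrite -(compl_pHall _ sylZ).
have [_ mulZL] := complP complL.
have sLK : L \subset K by rewrite -mulZL mulG_subr.
rewrite /normal sLK -mulZL mul_subG ?normG // cents_norm // centsC.
by rewrite (subset_trans sLK) // (subset_trans sKG) // centsC.
Qed.

(** * Fusion criteria for p-nilpotence *)

(** Write [g = k * s] with [k] in the complement [K]. For [x] in [P], [[~ x, k]] lies in [S] with
    [x] and [x ^ k], and in [K] by normality, so it is trivial. *)
Lemma p_nilpotent_control (p : nat) (gT : finGroupType) (G S : {group gT}) :
  p.-Sylow(G) S -> p_nilpotent p G -> controls_fusion S S G.
Proof.
move=> sylS [K [nsKG hallK]] P g sPS Gg sPgS; have [sKG nKG] := andP nsKG.
have /complP[tiKS mulKS] : S \in [complements to K in G].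
  by rewrite (compl_p'Hall S hallK).
have /mulsgP[k s Kk Ss def_g] : g \in K * S by rewrite mulKS.
rewrite def_g; apply: mem_mulg => //; rewrite in_setI (subsetP sKG k Kk) /=.
have sPkS : P :^ k \subset S.
  by rewrite -(conjSg _ _ s) -conjsgM -def_g (conjGid Ss).
apply/centP=> x Px.
have Sx := subsetP sPS x Px; have Gx := subsetP (pHall_sub sylS) x Sx.
have Sxk : [~ x, k] \in S.
  by rewrite commgEl groupM ?groupV // (subsetP sPkS) // memJ_conjg.
have Kxk : [~ x, k] \in K.
  by rewrite commgEr groupM // memJ_norm ?groupV // (subsetP nKG).
apply/esym/commgP/eqP/set1P; rewrite -set1gE -tiKS.
by rewrite in_setI Kxk.
Qed.

Lemma control_p_automizer (p : nat) (gT : finGroupType) (G S P : {group gT}) :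
    p.-group S -> controls_fusion S S G -> P \subset S ->
  p.-group ('N_G(P) / 'C(P)).
Proof.
move=> pS ctl sPS.
apply: (@pgroupS _ _ ('N_S(P) / 'C(P))); last first.
  exact: quotient_pgroup (pgroupS (subsetIl _ _) pS).
rewrite quotientSK; last by rewrite subIset ?cent_norm ?orbT.
apply/subsetP=> n /setIP[Gn nPn].
have: n \in 'C_G(P) * S by apply: ctl; rewrite ?(normP nPn).
case/mulsgP=> c s /setIP[Gc cPc] Ss def_n.
rewrite def_n mem_mulg // inE Ss /= -(groupMl _ (subsetP (cent_sub P) c cPc)).
by rewrite -def_n.
Qed.

(** Transfer yields a proper normal [N] with p-group quotient. Automizers in [N] are subgroups of
    those in [G], so induction on the order applies to [N]. *)
Lemma frobenius_p_nilpotent (p : nat) (gT : finGroupType) (G S : {group gT}) :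
    p.-Sylow(G) S ->
    (forall P : {group gT}, P \subset S -> p.-group ('N_G(P) / 'C(P))) ->
  p_nilpotent p G.
Proof.
have [n] := ubnP #|G|; elim: n => // n IHn in G S * => /ltnSE-leGn sylS autS.
have [sSG pS _] := and3P sylS.
have scS : strongly_closed S S G by split.
have ctl : controls_fusion S S G.
  by apply: (strongly_closed_control sylS scS) => Q sQS _; apply: autS.
have [S1 | ntS] := eqsVneq S 1.
  exists G; split=> //; rewrite /pHall subxx indexgg /=.
  rewrite andbT -partG_eq1 -(card_Hall sylS) S1 cards1 //.
have [x u|N [prNG nsNG pGN]] := transfer_p_quotient sylS ntS.
  exact: control_conj ctl.
apply: (p_nilpotent_ext nsNG pGN).
apply: (IHn N (N :&: S)%G); first exact: leq_trans (proper_card prNG) leGn.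
  exact: Sylow_setI_normal nsNG sylS.
move=> P sPNS; apply: pgroupS (autS P (subset_trans sPNS (subsetIr _ _))).
by rewrite quotientS ?setSI // normal_sub.
Qed.

(* Both [Z] and [Z :^ g] centralise [P :^ g]; Sylow's theorem in
   ['C_G(P :^ g)] corrects [g] so that it centralises [Z]. *)
Lemma central_control (p : nat) (gT : finGroupType) (G S Z : {group gT}) :
    p.-Sylow(G) S -> Z \subset 'Z(S) ->
    (forall y, y \in G -> Z :^ y \subset S -> y \in 'C(Z)) ->
  p_nilpotent p 'C_G(Z) -> controls_fusion S S G.
Proof.
move=> sylS sZZ fixZ nilM P g sPS Gg sPgS; have [sSG pS _] := and3P sylS.
have [sZS cSZ] := subsetIP sZZ.
have sSM : S \subset 'C_G(Z) by rewrite subsetI sSG centsC.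
have sylM : p.-Sylow('C_G(Z)) S := pHall_subl sSM (subsetIl _ _) sylS.
pose Q := (P :^ g)%G.
have sZCQ : Z \subset 'C_G(Q).
  by rewrite subsetI (subset_trans sZS) // (subset_trans cSZ) // centS.
have sZgCQ : Z :^ g \subset 'C_G(Q).
  rewrite subsetI -{1}(conjGid Gg) conjSg (subset_trans sZS) //= centJ conjSg.
  by rewrite (subset_trans cSZ) // centS.
have pZ : p.-group Z := pgroupS sZS pS.
have [T sylT sZT] := Sylow_superset sZCQ pZ.
have [|c CQc sZgcT] := Sylow_Jsub sylT sZgCQ; first by rewrite pgroupJ.
have [sTC pT _] := and3P sylT.
(* [fixZ] only sees conjugates of [Z] inside [S]. Since [S :^ x] contains both [Z] and
   [Z :^ (g * c)], it applies to [x^-1] and to [g * c * x^-1]. *)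
have [x Gx sTSx] := Sylow_subJ sylS (subset_trans sTC (subsetIl _ _)) pT.
have [Gc cQc] := setIP CQc.
have cZx : x \in 'C(Z).
  by rewrite -groupV fixZ ?groupV // sub_conjgV (subset_trans sZT).
have cZgc : g * c \in 'C(Z).
  rewrite -(groupMr _ (groupVr cZx)) fixZ ?groupM ?groupV // 2!conjsgM sub_conjgV.
  exact: subset_trans sZgcT sTSx.
have Qc : Q :^ c = Q by rewrite (normP (subsetP (cent_sub Q) c cQc)).
have Pgc : P :^ (g * c) = Q by rewrite conjsgM Qc.
have gcP : g * c \in 'C_G(P) * S.
  have: g * c \in 'C_('C_G(Z))(P) * S.
    by apply: (p_nilpotent_control sylM nilM); rewrite ?Pgc // inE groupM.
  by apply/subsetP/mulSg/setSI; rewrite subsetIl.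
rewrite -(mulgK c g); apply: cent_mulM => //.
by rewrite Pgc -[c^-1]mulg1 mem_mulg // groupV.
Qed.

(** * From a strongly closed subgroup to the whole group *)

Lemma strongly_closed_p_nilpotent (p : nat) (gT : finGroupType) (G S D : {group gT}) :
    p.-Sylow(G) S -> strongly_closed D S G ->
    (forall x g, x \in D -> g \in G -> x ^ g \in D ->
       exists2 s, s \in S & x ^ g = x ^ s) ->
  p_nilpotent p 'N_G(D) -> p_nilpotent p G.
Proof.
have [n] := ubnP #|G|.
elim: n => // n IHn in gT G S D * => /ltnSE-leGn sylS scD ctlD nilND.
have [sSG pS _] := and3P sylS; have [sDS _ scDx] := scD.
have sDG := subset_trans sDS sSG.
have [D1 | ntD] := eqsVneq D 1.
  by move: nilND; rewrite D1 norm1 setIT.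
have nsDS : D <| S.
  rewrite /normal sDS; apply/subsetP=> s Ss; rewrite inE.
  by apply: (strongly_closed_conj scD); rewrite ?(subsetP sSG) // -(conjGid Ss) conjSg.
pose Z := (D :&: 'Z(S))%G.
have ntZ : Z :!=: 1 := meet_center_nil (pgroup_nil pS) nsDS ntD.
have sZD : Z \subset D := subsetIl _ _.
have sZZ : Z \subset 'Z(S) := subsetIr _ _.
have [sZS cSZ] := subsetIP sZZ.
(* A conjugate of [z] in [S] lies in [D] by strong closure, so it is an [S]-conjugate of [z], which
   is central in [S]. *)
have fixZ y : y \in G -> Z :^ y \subset S -> y \in 'C(Z).
  move=> Gy sZyS; apply/centP=> z Zz; apply/esym/commgP/conjg_fixP.
  have Dz := subsetP sZD z Zz.
  have Dzy : z ^ y \in D by rewrite scDx // (subsetP sZyS) // memJ_conjg.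
  have [s Ss ->] := ctlD z y Dz Gy Dzy.
  by apply/conjg_fixP/commgP/(centsP cSZ).
have sMG : 'C_G(Z) \subset G := subsetIl _ _.
have sSM : S \subset 'C_G(Z) by rewrite subsetI sSG centsC.
have sylM : p.-Sylow('C_G(Z)) S := pHall_subl sSM sMG sylS.
have nZM : 'C_G(Z) \subset 'N(Z) by rewrite subIset ?cent_sub ?orbT.
have nZS := subset_trans sSM nZM; have nZD := subset_trans sDS nZS.
have sZM := subset_trans sZS sSM.
have pZ : p.-group Z := pgroupS sZS pS.
have memQ (A : {group gT}) x : Z \subset A -> x \in 'N(Z) ->
    (coset Z x \in A / Z) = (x \in A).
  by move=> sZA nZx; rewrite -!sub1set -quotient_set1 // quotientSGK ?sub1set.
suff nilM : p_nilpotent p 'C_G(Z).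
  apply: (frobenius_p_nilpotent sylS) => P.
  exact: control_p_automizer pS (central_control sylS sZZ fixZ nilM).
apply: (@p_nilpotent_central_quotient _ _ _ Z) => //.
  by rewrite subsetI sZM centsC subsetIr.
(* Dividing by the nontrivial [Z] lowers the order even when ['C_G(Z)] is all of [G]. *)
apply: (IHn _ _ (S / Z)%G (D / Z)%G).
- apply: leq_trans leGn; apply: leq_trans (subset_leq_card sMG).
  by rewrite ltn_quotient.
- exact: quotient_pHall.
- split; rewrite ?quotientS // => _ _ /morphimP[x nZx Dx ->] /morphimP[g nZg Mg ->].
  have nZxg : x ^ g \in 'N(Z) by rewrite groupJ.
  rewrite -morphJ // !memQ // => Sxg.
  by rewrite scDx // (subsetP sMG).
- move=> _ _ /morphimP[x nZx Dx ->] /morphimP[g nZg Mg ->].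
  have nZxg : x ^ g \in 'N(Z) by rewrite groupJ.
  rewrite -morphJ // memQ // => Dxg.
  have [s Ss eq_s] := ctlD x g Dx (subsetP sMG g Mg) Dxg.
  by exists (coset Z s); rewrite ?mem_quotient // eq_s morphJ // (subsetP nZS).
(* As [Z] lies in [D], the normaliser of [D / Z] is the image of that of [D] in ['C_G(Z)], a
   subgroup of ['N_G(D)]. *)
rewrite /= -quotient_subnormG; last by rewrite /normal sZD.
apply: quotient_p_nilpotent; first by rewrite subIset ?nZM.
by apply: p_nilpotentS nilND; rewrite setSI.
Qed.

(** [U] and the complement [K] are normal in ['N_G(U)] and of coprime orders, so they commute; the
    automizer is thus a quotient of ['N_G(U) / K]. *)
Lemma p_nilpotent_p_automizer (p : nat) (gT : finGroupType) (G U : {group gT}) :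
  p.-group U -> U \subset G -> p_nilpotent p 'N_G(U) -> p.-group ('N_G(U) / 'C(U)).
Proof.
move=> pU sUG [K [nsKN hallK]]; have [sKN p'K pKN] := and3P hallK.
have nsUN : U <| 'N_G(U) by rewrite normal_subnorm.
have cUK : K \subset 'C(U).
  have tiKU : K :&: U = 1.
    by rewrite setIC; apply: coprime_TIg (pnat_coprime pU p'K).
  apply/commG1P/trivgP; rewrite -tiKU commg_subI // subsetI ?subxx.
    by rewrite (subset_trans sKN) // subsetIr.
  by rewrite (subset_trans (normal_sub nsUN)) // normal_norm.
have nCK : K \subset 'N('C(U)).
  by rewrite (subset_trans sKN) // subIset ?cent_norm ?orbT.
have hallKb := quotient_pHall nCK hallK.
rewrite -pgroupNK -partG_eq1 -(card_Hall hallKb).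
have -> : (K / 'C(U))%G :=: 1 by exact: quotientS1.
by rewrite cards1.
Qed.

Theorem corollary6 (p : nat) (gT : finGroupType) (G S D : {group gT})
    (p_pr : prime p) (sylS : S \in 'Syl_p(G)) (scD : strongly_closed D S G) :
  p_nilpotent p G <->
  (forall U : {group gT}, U \subset D -> 'C_D(U) \subset U ->
     p_nilpotent p 'N_G(U)).
Proof.
move: sylS; rewrite inE => sylS; have [sSG pS _] := and3P sylS.
have [sDS _ _] := scD; split=> [nilG U _ _ | nilN].
  exact: p_nilpotentS (subsetIl _ _) nilG.
have ctl : controls_fusion S D G.
  apply: (strongly_closed_control sylS scD) => U sUD sCU.
  have sUS := subset_trans sUD sDS.
  apply: p_nilpotent_p_automizer (nilN U sUD sCU); first exact: pgroupS sUS pS.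
  exact: subset_trans sUS sSG.
(* The hypothesis covers [U = D], since ['C_D(D)] lies in [D]. *)
apply: (strongly_closed_p_nilpotent sylS scD); last first.
  by apply: nilN => //; apply: subsetIl.
by move=> x g; apply: control_conj ctl.
Qed.
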